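(* Let $\lambda_1,\mu_1,\lambda_2$ be real numbers and $\varepsilon>0$. Set $A=\max\left(1,2\left\lceil 2\pi\frac{|\lambda_1|+|\mu_1|}{\varepsilon}\right\rceil\right)$. Let $\theta_1,\theta_2$ be real numbers and set $s=\lambda_1^2+\mu_1^2+2\lambda_1\mu_1\cos\theta_1$. Then for every even integer $n\ge A$ and all integers $1\le k,\ell\le n-1$ with $\gcd(k,n/2)=1$, there is $t\in\mathbb{Z}$ such that \[\lambda_1\cos\frac{k(\theta_1+2\pi t)}{n}+\mu_1\cos\frac{(n-k)(\theta_1+2\pi t)}{n}+\lambda_2\cos\frac{\theta_2+2\pi t}{2}>\sqrt{s}-\varepsilon.\] *)

(* Defs.v *)
From mathcomp Require Export all_boot all_order all_algebra.
From mathcomp Require Export all_classical all_reals all_analysis.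

(* Main.v *)
(* Put alpha = k (theta1 + 2 pi t) / n.  The first two terms sum to
   lambda1 cos alpha + mu1 cos (theta1 - alpha) = sqrt s * cos (beta - alpha)
   with beta independent of t.  The parity of t alone decides the sign of the
   lambda2 term, so it can be chosen to make that term nonnegative; as t runs
   over one parity class, alpha runs modulo 2 pi over a coset of the multiples
   of 2 pi / (n/2), because k is coprime to n/2.  Hence some t satisfies
   0 <= beta - alpha < 4 pi / n modulo 2 pi, and 1 - cos d <= d loses less
   than eps. *)
Require Import Defs.
From mathcomp Require Import all_boot all_order all_algebra.
From mathcomp Require Import all_classical all_reals all_analysis.
From mathcomp Require Import lra ring zify.
Import Order.TTheory GRing.Theory Num.Theory.
Import numFieldNormedType.Exports.
Local Open Scope ring_scope.

Lemma cosD2piz (R : realType) (x : R) (z : int) :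
  cos (x + 2 * pi * z%:~R) = cos x.
Proof.
have cosDn (y : R) n : cos (y + 2 * pi * n%:R) = cos y.
  elim: n => [|n IHn]; first by rewrite mulr0 addr0.
  rewrite -[RHS]IHn -[RHS]cosD2pi; congr cos.
  by rewrite -natr1 -mulr_natl; ring.
case: z => n; first exact: cosDn.
rewrite -[LHS](cosDn _ n.+1); congr cos.
by rewrite NegzE mulrNz; ring.
Qed.

(** By the mean value theorem on [[0, x]], the left side is [x * sin c], and [sin c <= 1]. *)
Lemma subr1_cos_le (R : realType) (x : R) : 0 <= x -> 1 - cos x <= x.
Proof.
move=> x0; have cont : {within `[0, x], continuous (cos : R -> R)}%classic.
  by apply: continuous_subspaceT; exact: continuous_cos.
have [c cx] := MVT_segment x0 (fun y _ => is_derive_cos y) cont.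
rewrite cos0 subr0 => Ex; have := sin_le1 c; nra.
Qed.

(** For [r] nonzero, [acos (a / r)] has the right cosine and sine [|b| / r]; the sign of [b] decides
    whether to negate the angle. *)
Lemma polar_coordinates (R : realType) (a b : R) :
  exists beta : R, let r := Num.sqrt (a ^+ 2 + b ^+ 2) in
    a = r * cos beta /\ b = r * sin beta.
Proof.
set r := Num.sqrt _.
have r2 : r ^+ 2 = a ^+ 2 + b ^+ 2 by rewrite sqr_sqrtr// addr_ge0 ?sqr_ge0.
have r0 : 0 <= r by exact: sqrtr_ge0.
have [r_eq0|r_neq0] := eqVneq r 0.
  move: r2; rewrite r_eq0 => r2; exists 0; rewrite /= !mul0r; split; nra.
have r_gt0 : 0 < r by rewrite lt_def r_neq0.
have ar : -1 <= a / r <= 1 by rewrite ler_pdivlMr// ler_pdivrMr//; apply/andP; split; nra.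
have ra : r * (a / r) = a by field.
have sinE : sin (acos (a / r)) = `|b| / r.
  rewrite sin_acos// -[`|b| / r]ger0_norm ?divr_ge0// -sqrtr_sqr; congr Num.sqrt.
  rewrite !expr_div_n real_normK ?num_real//.
  have -> : b ^+ 2 = r ^+ 2 - a ^+ 2 by rewrite r2; ring.
  by field.
have [b0|b0] := lerP 0 b.
- exists (acos (a / r)); rewrite acosK ?sinE ?in_itv//= ra ger0_norm//.
  by split=> //; field.
- exists (- acos (a / r)); rewrite cosN sinN acosK ?sinE ?in_itv//= ra ltr0_norm//.
  by split=> //; field.
Qed.

(** By Bezout, [k * u0 + m * v0 = 1], so [u = u0 * j] and [q = v0 * j] produce a shift of exactly
    [j] steps of length [2 * pi / m]; [j] is the number of whole steps from [x] to [y]. *)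
Lemma coprime_multiples_approx (R : realType) (k m : int) (x y : R) :
  0 < m -> gcdz k m = 1 ->
  exists u q : int,
    0 <= y - (x + 2 * pi * (k * u)%:~R / m%:~R + 2 * pi * q%:~R)
      < 2 * pi / m%:~R.
Proof.
move=> m_gt0 km1; have [u0 [v0]] := Bezoutz k m; rewrite km1 => bezout.
have m0 : 0 < m%:~R :> R by rewrite ltr0z.
have p0 := pi_gt0 R.
pose w : R := (y - x) * m%:~R / (2 * pi); pose j := Num.floor w.
exists (u0 * j), (v0 * j).
have -> : x + 2 * pi * (k * (u0 * j))%:~R / m%:~R + 2 * pi * (v0 * j)%:~R
    = x + 2 * pi * j%:~R / m%:~R.
  rewrite -{3}[j]mul1r -bezout !rmorphM rmorphD !rmorphM/=.
  by field; rewrite gt_eqF.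
have -> : y - (x + 2 * pi * j%:~R / m%:~R) = (w - j%:~R) * (2 * pi / m%:~R).
  by rewrite /w; move: (pi : R) p0 => P p0; field; rewrite !gt_eqF.
have c0 : 0 < 2 * pi / m%:~R :> R by rewrite divr_gt0// mulr_gt0.
have /andP[jw] := floor_itv w; rewrite intrD -/j => wj.
by rewrite pmulr_lge0// subr_ge0 jw/= gtr_pMl//; lra.
Qed.

(** Passing from [p = 0] to [p = 1] adds [pi] to the angle and flips the sign, while [2 * u] only
    adds whole turns. *)
Lemma cos_parity_ge0 (R : realType) (a x : R) :
  exists p : int, forall u : int,
    0 <= a * cos ((x + 2 * pi * (p + 2 * u)%:~R) / 2).
Proof.
have half (p u : int) : cos ((x + 2 * pi * (p + 2 * u)%:~R) / 2)
    = cos (x / 2 + pi * p%:~R).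
  rewrite -[RHS](cosD2piz _ _ u); congr cos.
  by rewrite intrD intrM; field.
have [h|h] := lerP 0 (a * cos (x / 2)).
  by exists 0 => u; rewrite half mulr0 addr0.
by exists 1 => u; rewrite half mulr1 cosDpi mulrN oppr_ge0 ltW.
Qed.

Theorem theorem6p10 (R : realType) (lambda1 mu1 lambda2 eps : R)
    (eps_gt0 : 0 < eps) (theta1 theta2 : R) :
  let A : int :=
    Num.max 1 (2 * Num.ceil (2 * pi * ((`|lambda1| + `|mu1|) / eps))) in
  let s : R := lambda1 ^+ 2 + mu1 ^+ 2 + 2 * lambda1 * mu1 * cos theta1 in
  forall n : int, (2 %| n)%Z -> A <= n ->
  forall k l : int, 1 <= k <= n - 1 -> 1 <= l <= n - 1 ->
    gcdz k (n %/ 2)%Z = 1 ->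
  exists t : int,
    Num.sqrt s - eps
    < lambda1 * cos (k%:~R * (theta1 + 2 * pi * t%:~R) / n%:~R)
      + mu1 * cos ((n - k)%:~R * (theta1 + 2 * pi * t%:~R) / n%:~R)
      + lambda2 * cos ((theta2 + 2 * pi * t%:~R) / 2).
Proof.
move=> A s n /dvdzP[m ->] An k l /andP[k_ge1 k_le] _; rewrite mulzK// => km1.
have m_gt0 : 0 < m by lia.
have m0 : 0 < m%:~R :> R by rewrite ltr0z.
have p0 := pi_gt0 R.
have [beta [ab bb]] := polar_coordinates R (lambda1 + mu1 * cos theta1)
  (mu1 * sin theta1).
have sE : (lambda1 + mu1 * cos theta1) ^+ 2 + (mu1 * sin theta1) ^+ 2 = s.
  by rewrite /s [(mu1 * sin _) ^+ 2]exprMn sin2cos2; ring.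
rewrite {}sE in ab bb; set r := Num.sqrt s in ab bb *.
have r0 : 0 <= r by exact: sqrtr_ge0.
have [p p_ge0] := cos_parity_ge0 R lambda2 theta2.
(* As [n = m * 2], raising [t] from [p] to [p + 2 * u] turns the angle by [2 * pi * (k * u) / m]. *)
have [u [q /andP[d0 dlt]]] := coprime_multiples_approx R k m
  (k%:~R * (theta1 + 2 * pi * p%:~R) / (m * 2)%:~R) beta m_gt0 km1.
set d := beta - _ in d0 dlt; exists (p + 2 * u).
have := p_ge0 u; set c2 := lambda2 * _ => c2_ge0.
set a := k%:~R * _ / _.
have -> : (m * 2 - k)%:~R * (theta1 + 2 * pi * (p + 2 * u)%:~R) / (m * 2)%:~R
    = theta1 - a + 2 * pi * (p + 2 * u)%:~R.
  rewrite /a !(intrB, intrD, intrM); field; rewrite gt_eqF//.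
have dE : beta - a = d + 2 * pi * q%:~R.
  rewrite /a /d !(intrD, intrM); field; rewrite gt_eqF//.
have sumE : lambda1 * cos a + mu1 * cos (theta1 - a) = r * cos d.
  rewrite -(cosD2piz _ d q) -dE !cosB !mulrDr !mulrA -ab -bb; ring.
rewrite cosD2piz sumE.
suff : r * (1 - cos d) < eps by lra.
have r_le : r <= `|lambda1| + `|mu1|.
  rewrite -[leRHS]ger0_norm ?addr_ge0// -sqrtr_sqr ler_wsqrtr// /s.
  have : lambda1 * mu1 * cos theta1 <= `|lambda1| * `|mu1|.
    by rewrite (le_trans (ler_norm _))// !normrM ler_piMr ?mulr_ge0 ?cos_max.
  rewrite -[lambda1 ^+ 2]real_normK ?num_real// -[mu1 ^+ 2]real_normK ?num_real//.
  nra.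
(* The factor 2 before the ceiling in [A] cancels against [n = m * 2]. *)
have m_ge : 2 * pi * (`|lambda1| + `|mu1|) <= eps * m%:~R.
  have : Num.ceil (2 * pi * ((`|lambda1| + `|mu1|) / eps)) <= m by lia.
  by rewrite ceil_le_int mulrA ler_pdivrMr// [eps * _]mulrC.
(* Multiplying [d < 2 * pi / m] by [r] stays strict only for [r > 0]. *)
have [->|r_neq0] := eqVneq r 0; first by rewrite mul0r.
have r_gt0 : 0 < r by rewrite lt_def r_neq0.
apply: (@le_lt_trans _ _ (r * d)); first by rewrite ler_wpM2l// subr1_cos_le.
apply: (@lt_le_trans _ _ (r * (2 * pi / m%:~R))); first by rewrite ltr_pM2l.
rewrite mulrA ler_pdivrMr//; nra.
Qed.
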